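(* Let $\mathbf{Q}$ be a quantale, $X,Y$ non-empty sets and $p\in Q^{X\times Y}$ a strong coder. Let $H_p:Q^X\to Q^Y$, $H_pf(y)=\bigvee_{x\in X}f(x)\cdot p(x,y)$, and $\Lambda_p:Q^Y\to Q^X$, $\Lambda_pg(x)=\bigwedge_{y\in Y}g(y)/p(x,y)$. Then $H_p\circ\Lambda_p=\mathrm{id}_{Q^Y}$; consequently $H_p$ is surjective and $\Lambda_p$ is injective.
   Context: A quantale is $\mathbf{Q}=\langle Q,\vee,\cdot,\bot,e\rangle$ with $\langle Q,\vee,\bot\rangle$ a complete lattice, $\langle Q,\cdot,e\rangle$ a monoid, multiplication distributing over arbitrary joins on both sides; $y/x=\bigvee\{z\mid zx\le y\}$. A map $p\in Q^{X\times Y}$ is a strong coder if there is an injective map $\varepsilon:Y\to X$ with $p(\varepsilon(y),y)=e$ for all $y\in Y$ and $p(\varepsilon(y_1),y_2)=\bot$ for all $y_1\neq y_2$ in $Y$. *)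

(* Defs.v *)
From HB Require Import structures.
From mathcomp Require Import all_boot all_order.
From mathcomp Require Import boolp classical_sets functions.

Set Implicit Arguments.
Unset Strict Implicit.
Unset Printing Implicit Defensive.

Local Open Scope classical_set_scope.
Local Open Scope group_scope.
Local Open Scope order_scope.

HB.mixin Record hasArbitraryJoins (d : Order.disp_t) T of Order.TBLattice d T := {
  bigjoin : set T -> T;
  bigjoinP : forall A : set T, supremums A (bigjoin A)
}.

#[short(type="completeLatticeType")]
HB.structure Definition CompleteLattice (d : Order.disp_t) :=
  { T of hasArbitraryJoins d T & Order.TBLattice d T }.

HB.mixin Record isQuantale (d : Order.disp_t) T
    of CompleteLattice d T & monoid.Monoid T := {
  mul_bigjoinr : forall (a : T) (B : set T),
    a * bigjoin B = bigjoin [set a * b | b in B];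
  mul_bigjoinl : forall (A : set T) (b : T),
    bigjoin A * b = bigjoin [set a * b | a in A]
}.

#[short(type="quantaleType")]
HB.structure Definition Quantale (d : Order.disp_t) :=
  { T of isQuantale d T & CompleteLattice d T & monoid.Monoid T }.

(* In a complete lattice, the meet of A is the join of its lower bounds. *)
Definition bigmeet (d : Order.disp_t) (L : completeLatticeType d)
  (A : set L) : L := bigjoin (lbound A).

Section Residuated.
Context (d : Order.disp_t) (Q : quantaleType d).

(* The residual y / x; the library's [y / x] in group_scope is y * x^-1. *)
Definition residual (y x : Q) : Q := bigjoin [set z : Q | z * x <= y].

Context (X Y : Type).

Definition strong_coder (p : X * Y -> Q) : Prop :=
  exists eps : Y -> X,
    [/\ injective eps,
        (forall y : Y, p (eps y, y) = 1)
      & (forall y1 y2 : Y, y1 <> y2 -> p (eps y1, y2) = \bot)].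

Definition H_ (p : X * Y -> Q) (f : X -> Q) : Y -> Q :=
  fun y => bigjoin (range (fun x : X => f x * p (x, y))).

Definition Lambda_ (p : X * Y -> Q) (g : Y -> Q) : X -> Q :=
  fun x => bigmeet (range (fun y : Y => residual (g y) (p (x, y)))).

End Residuated.

(* Main.v *)
(** The composite [H_ p \o Lambda_ p] is always below the identity, by the
    residuation adjunction. For the converse, fix [g] and [y]: since the column
    entries [p (eps y, y')] are [1] at [y' = y] and [\bot] elsewhere,
    [g y] is below every [g y' / p (eps y, y')], hence below
    [Lambda_ p g (eps y)], and the term at [x = eps y] of the join defining
    [H_ p (Lambda_ p g) y] is already above [g y]. *)
Require Import Defs.
From mathcomp Require Import all_boot all_order.
From mathcomp Require Import boolp classical_sets functions.

Import Order.TTheory.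
Local Open Scope classical_set_scope.
Local Open Scope group_scope.
Local Open Scope order_scope.

Section CompleteLatticeTheory.
Context (d : Order.disp_t) (L : completeLatticeType d).
Implicit Types (A : set L) (x : L).

Lemma bigjoin_ub A x : A x -> x <= bigjoin A.
Proof. by have [ubA _] := bigjoinP A; exact: ubA. Qed.

Lemma bigjoin_le A x : ubound A x -> bigjoin A <= x.
Proof. by have [_ lubA] := bigjoinP A; exact: lubA. Qed.

(** Each member of [A] is an upper bound of [lbound A]. *)
Lemma bigmeet_lb A x : A x -> bigmeet A <= x.
Proof. by move=> Ax; apply: bigjoin_le => z; exact. Qed.

Lemma le_bigmeet A x : lbound A x -> x <= bigmeet A.
Proof. exact: bigjoin_ub. Qed.

Lemma bigjoin0 : bigjoin (@set0 L) = \bot.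
Proof. by apply/le_anti; rewrite le0x andbT; apply: bigjoin_le => z []. Qed.

End CompleteLatticeTheory.

Section QuantaleTheory.
Context (d : Order.disp_t) (Q : quantaleType d).
Implicit Types a b c : Q.

(** [\bot] is the empty join, over which multiplication distributes. *)
Lemma quantale_mul0 a : a * \bot = \bot.
Proof. by rewrite -bigjoin0 mul_bigjoinr image_set0. Qed.

(* Monotonicity is distributivity over the join of the pair [set a; b]. *)
Lemma quantale_le_mul2r c a b : a <= b -> a * c <= b * c.
Proof.
move=> ab.
have <- : bigjoin [set a; b] = b.
  apply/le_anti/andP; split; last by apply: bigjoin_ub; right.
  by apply: bigjoin_le => z [] ->.
rewrite mul_bigjoinl; apply: bigjoin_ub.
by exists a => //; left.
Qed.

(** Distributivity moves [c] inside the join, where each [z * c] is below [b]. *)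
Lemma residual_mul_le b c : residual b c * c <= b.
Proof. by rewrite mul_bigjoinl; apply: bigjoin_le => _ [z zcb <-]. Qed.

Lemma le_residual a b c : (a <= residual b c) = (a * c <= b).
Proof.
apply/idP/idP => [/(quantale_le_mul2r c) h|]; last exact: bigjoin_ub.
exact: le_trans h (residual_mul_le b c).
Qed.

Context (X Y : Type).
Implicit Types (p : X * Y -> Q) (g : Y -> Q).

Lemma H_Lambda_le p g y : H_ p (Lambda_ p g) y <= g y.
Proof.
apply: bigjoin_le => _ [x _ <-].
(* By adjunction it suffices that [Lambda_ p g x] is below one of the residuals of which it is the
   meet. *)
by rewrite -le_residual; apply: bigmeet_lb; exists y.
Qed.

Lemma H_Lambda_ge p g y : strong_coder p -> g y <= H_ p (Lambda_ p g) y.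
Proof.
move=> [eps [_ p1 p0]].
have gy_le : g y <= Lambda_ p g (eps y).
  apply: le_bigmeet => _ [y' _ <-]; rewrite le_residual.
  (* Equality on the bare type [Y] is decided classically. *)
  have [<-|neq] := pselect (y = y'); first by rewrite p1 mulg1.
  by rewrite p0 // quantale_mul0 le0x.
apply: le_trans gy_le _; apply: bigjoin_ub.
by exists (eps y); rewrite // p1 mulg1.
Qed.

Lemma Lambda_K p : strong_coder p -> cancel (Lambda_ p) (H_ p).
Proof.
move=> p_strong g; apply/funext => y.
by apply/le_anti; rewrite H_Lambda_le H_Lambda_ge.
Qed.

End QuantaleTheory.

Theorem theorem5p12 (d : Order.disp_t) (Q : quantaleType d) (X Y : Type)
    (X_nonempty : inhabited X) (Y_nonempty : inhabited Y)
    (p : X * Y -> Q) (p_strong : strong_coder p) :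
  [/\ H_ p \o Lambda_ p = id,
      (forall g : Y -> Q, exists f : X -> Q, H_ p f = g)
    & injective (Lambda_ p)].
Proof.
have HK := Lambda_K _ _ _ _ _ p_strong.
split; first by apply/funext; exact: HK.
- by move=> g; exists (Lambda_ p g); exact: HK.
- exact: can_inj HK.
Qed.
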